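(* Let $(S_t)_{0\le t\le T}$ be the price process of a financial market on a Dedekind complete Riesz space $E$ with weak order unit $e$ and filtration $(\mathbb{F}_t)_{0\le t\le T}$. If for every component $p>0$ of $e$ we have $$p\,(S_{t}-m_{\mathbb{F}_{t}}(S_{t+1}))>0\quad\text{and}\quad p\,(M_{\mathbb{F}_{t}}(S_{t+1})-S_{t})>0\qquad\text{for any } t\leq T-1,$$ then the NA (no arbitrage) condition is equivalent to the AIP (absence of immediate profit) condition.
   Context: $E$ is a Dedekind complete Riesz space with weak order unit $e$; $E^{u}$ is its universal completion, an $f$-algebra with unit $e$, in which products are taken. A component of $e$ is an element $p\in E^{+}$ with $p\wedge(e-p)=0$; $x>0$ means $x\geq 0$ and $x\neq 0$. A conditional expectation on $E$ is a strictly positive order continuous linear projection $\mathbb{F}$ with $\mathbb{F}e=e$ whose range is a Dedekind complete Riesz subspace. It extends uniquely to a conditional expectation, still denoted $\mathbb{F}$, on its natural domain $\mathcal{L}^{1}(\mathbb{F})$, the largest Riesz subspace of $E^{u}$ to which $\mathbb{F}$ so extends (its positive elements are those $z\in E^{u}_{+}$ for which there is a net $0\le x_\alpha\uparrow z$ in $E$ with $(\mathbb{F}x_\alpha)$ order bounded in $E^{u}$, and then $\mathbb{F}z=\sup_\alpha\mathbb{F}x_\alpha$). $R(\mathbb{F})$ is the range of this extension (a universally complete $f$-subalgebra of $E^{u}$); $R(\mathbb{F})^{+}$ and $R(\mathbb{F})^{-}$ are its sets of elements $\geq 0$ and $\leq 0$. $\mathcal{L}^{\infty}(\mathbb{F})$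 is the ideal of $E^{u}$ generated by $R(\mathbb{F})$; for $f\in\mathcal{L}^{\infty}(\mathbb{F})$, $M_{\mathbb{F}}(f)=\inf\{g\in R(\mathbb{F}): f\leq g\}$ and $m_{\mathbb{F}}(f)=\sup\{g\in R(\mathbb{F}): g\leq f\}$. Financial market: $T\geq 1$ is an integer horizon, times are $0,1,\dots,T$, and $(\mathbb{F}_t)_{0\le t\le T}$ is a filtration, i.e. a family of conditional expectations on $E$ with $\mathbb{F}_i\mathbb{F}_j=\mathbb{F}_j\mathbb{F}_i=\mathbb{F}_i$ for $i<j$ (so $R(\mathbb{F}_i)\subset R(\mathbb{F}_j)$). The price process satisfies $S_t\in R(\mathbb{F}_t)$, $S_t\geq 0$, and $S_{t+1}\in\mathcal{L}^{\infty}(\mathbb{F}_t)$ for $0\le t<T$. Put $\Delta S_i=S_i-S_{i-1}$ and $$\mathcal{V}_{t,T}=\Big\{\sum_{i=t+1}^{T}\theta_{i-1}\Delta S_i:\ \theta_i\in R(\mathbb{F}_i)\Big\}.$$ Let $P_{t,T}=\{p_t\in R(\mathbb{F}_t):\exists\, v\in\mathcal{V}_{t,T},\ p_t+v\geq 0\}$. AIP means $P_{t,T}\cap R(\mathbb{F}_t)^{-}=\{0\}$ for all $t<T$. NA means $\mathcal{V}_{t,T}\cap R(\mathbb{F}_T)^{+}=\{0\}$ for all $t\leq T$. *)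

(* Defs.v *)
From HB Require Import structures.
From mathcomp Require Import all_boot all_order all_algebra.
From mathcomp Require Import boolp classical_sets functions reals.

Set Implicit Arguments.
Unset Strict Implicit.
Unset Printing Implicit Defensive.

Import Order.TTheory GRing.Theory Num.Theory.
Local Open Scope classical_set_scope.
Local Open Scope ring_scope.

(* R : realType is a model of the real numbers. Order.Lattice is not inherited
   directly: hierarchy-builder would need a join below the already declared
   RealDomain. The lattice instances are put on the carriers instead, and the
   library operations `|` and `&` are used from there on. *)
HB.mixin Record POrderedLmodule_isRiesz (R : realType) V
    of GRing.Lmodule R V & Num.POrderedZmodule V := {
  riesz_lerD2r : forall z x y : V, x <= y -> x + z <= y + z;
  riesz_scaler_ge0 : forall (a : R) (x : V), 0 <= a -> 0 <= x -> 0 <= a *: x;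
  riesz_join : V -> V -> V;
  riesz_meet : V -> V -> V;
  riesz_leUx : forall x y z : V,
    (riesz_join x y <= z) = (x <= z) && (y <= z);
  riesz_lexI : forall x y z : V,
    (x <= riesz_meet y z) = (x <= y) && (x <= z);
}.

#[short(type="rieszType")]
HB.structure Definition Riesz (R : realType) :=
  { V of GRing.Lmodule R V & Num.POrderedZmodule V
       & POrderedLmodule_isRiesz R V }.

HB.instance Definition _ (R : realType) (V : rieszType R) :=
  Order.POrder_isMeetSemilattice.Build ring_display (@Riesz.sort R V)
    (@riesz_lexI R V).
HB.instance Definition _ (R : realType) (V : rieszType R) :=
  Order.POrder_isJoinSemilattice.Build ring_display (@Riesz.sort R V)
    (@riesz_leUx R V).

(* A commutative f-algebra with unit. The unit may be 0, so that the zero space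
   is not excluded. The ring structure is put on the carrier for the same
   reason as the lattice structure above. *)
HB.mixin Record Riesz_isFAlgebra (R : realType) V of Riesz R V := {
  falg_one : V;
  falg_mul : V -> V -> V;
  falg_mulA : associative falg_mul;
  falg_mulC : commutative falg_mul;
  falg_mul1 : left_id falg_one falg_mul;
  falg_mulDl : left_distributive falg_mul +%R;
  falg_scaleAl : forall (a : R) (x y : V),
    a *: falg_mul x y = falg_mul (a *: x) y;
  falg_mul_ge0 : forall x y : V, 0 <= x -> 0 <= y -> 0 <= falg_mul x y;
  falg_meet_mull : forall x y z : V,
    0 <= z -> riesz_meet x y = 0 -> riesz_meet (falg_mul z x) y = 0;
}.

#[short(type="fAlgType")]
HB.structure Definition FAlgebra (R : realType) :=
  { V of Riesz R V & Riesz_isFAlgebra R V }.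

HB.instance Definition _ (R : realType) (V : fAlgType R) :=
  Order.POrder_isMeetSemilattice.Build ring_display (@FAlgebra.sort R V)
    (@riesz_lexI R V).
HB.instance Definition _ (R : realType) (V : fAlgType R) :=
  Order.POrder_isJoinSemilattice.Build ring_display (@FAlgebra.sort R V)
    (@riesz_leUx R V).
HB.instance Definition _ (R : realType) (V : fAlgType R) :=
  GRing.Zmodule_isComPzRing.Build (@FAlgebra.sort R V)
    (@falg_mulA R V) (@falg_mulC R V) (@falg_mul1 R V) (@falg_mulDl R V).

Definition rabs {R : realType} {V : rieszType R} (x : V) : V := (x `|` - x)%O.
Definition rpos {R : realType} {V : rieszType R} (x : V) : V := (x `|` 0)%O.
Definition rneg {R : realType} {V : rieszType R} (x : V) : V := (- x `|` 0)%O.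

Definition riesz_subspace {R : realType} {V : rieszType R} (A : set V) : Prop :=
  [/\ A 0,
      forall (a : R) x y, A x -> A y -> A (a *: x + y),
      forall x y, A x -> A y -> A (x `|` y)%O &
      forall x y, A x -> A y -> A (x `&` y)%O].

(* Suprema are computed relative to A. *)
Definition dedekind_complete_on {R : realType} {V : rieszType R} (A : set V) :
    Prop :=
  forall B : set V, B `<=` A -> B !=set0 -> (A `&` ubound B) !=set0 ->
    exists s, (A `&` ubound B) s /\ lbound (A `&` ubound B) s.

Definition dedekind_complete {R : realType} (V : rieszType R) : Prop :=
  dedekind_complete_on [set: V].

(* Nonemptiness is needed: the empty set has no supremum in a nonzero space. *)
Definition laterally_complete {R : realType} (V : rieszType R) : Prop :=
  forall A : set V, A !=set0 -> (forall x, A x -> 0 <= x) ->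
    (forall x y, A x -> A y -> x <> y -> (x `&` y)%O = 0) ->
    supremums A !=set0.

Definition universally_complete {R : realType} (V : rieszType R) : Prop :=
  dedekind_complete V /\ laterally_complete V.

Definition weak_order_unit {R : realType} {V : rieszType R} (e : V) : Prop :=
  0 <= e /\ forall x : V, (rabs x `&` e)%O = 0 -> x = 0.

Definition component {R : realType} {V : rieszType R} (e p : V) : Prop :=
  0 <= p /\ (p `&` (e - p))%O = 0.

Definition riesz_hom {R : realType} {V W : rieszType R} (f : V -> W) : Prop :=
  [/\ linear f,
      forall x y, f (x `|` y)%O = (f x `|` f y)%O &
      forall x y, f (x `&` y)%O = (f x `&` f y)%O].

(* iota identifies E with an order dense Riesz subspace of the universally
   complete Riesz space U. *)
Definition universal_completion {R : realType} {E U : rieszType R}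
    (iota : E -> U) : Prop :=
  [/\ riesz_hom iota,
      injective iota,
      universally_complete U &
      forall u : U, 0 < u -> exists x : E, 0 < iota x /\ iota x <= u].

Definition directed {I : Type} (le : I -> I -> Prop) : Prop :=
  [/\ inhabited I,
      forall a, le a a,
      forall a b c, le a b -> le b c -> le a c &
      forall a b, exists c, le a c /\ le b c].

Definition net_up {R : realType} {V : rieszType R} {I : Type}
    (le : I -> I -> Prop) (x : I -> V) (z : V) : Prop :=
  (forall a b, le a b -> x a <= x b) /\ supremums (range x) z.

Definition net_down {R : realType} {V : rieszType R} {I : Type}
    (le : I -> I -> Prop) (x : I -> V) (z : V) : Prop :=
  (forall a b, le a b -> x b <= x a) /\ infimums (range x) z.

Definition order_cvg {R : realType} {V : rieszType R} {I : Type}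
    (le : I -> I -> Prop) (x : I -> V) (l : V) : Prop :=
  exists2 y : I -> V, net_down le y 0 & forall a, rabs (x a - l) <= y a.

Definition order_continuous {R : realType} {V W : rieszType R} (f : V -> W) :
    Prop :=
  forall (I : Type) (le : I -> I -> Prop), directed le ->
    forall (x : I -> V) (l : V),
      order_cvg le x l -> order_cvg le (f \o x) (f l).

Definition conditional_expectation {R : realType} {E : rieszType R} (e : E)
    (F : E -> E) : Prop :=
  [/\ linear F /\ (forall x, F (F x) = F x),
      forall x, 0 < x -> 0 < F x,
      order_continuous F,
      F e = e &
      riesz_subspace (range F) /\ dedekind_complete_on (range F)].

(* ext_pos iota F z w : z is in the positive cone of the natural domain of F
   inside the universal completion, and the extension of F maps z to w. *)
Definition ext_pos {R : realType} {E U : rieszType R} (iota : E -> U)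
    (F : E -> E) (z w : U) : Prop :=
  exists (I : Type) (le : I -> I -> Prop) (x : I -> E),
    [/\ directed le,
        forall a, 0 <= x a,
        net_up le (iota \o x) z,
        has_lbound (range (iota \o F \o x)) /\
          has_ubound (range (iota \o F \o x)) &
        supremums (range (iota \o F \o x)) w].

(* The graph of the extension of F to its natural domain. *)
Definition natural_ext {R : realType} {E U : rieszType R} (iota : E -> U)
    (F : E -> E) (z w : U) : Prop :=
  exists w1 w2, [/\ ext_pos iota F (rpos z) w1, ext_pos iota F (rneg z) w2 &
                    w = w1 - w2].

Definition ext_range {R : realType} {E U : rieszType R} (iota : E -> U)
    (F : E -> E) : set U :=
  [set w | exists z, natural_ext iota F z w].

Definition ext_range_ge0 {R : realType} {E U : rieszType R} (iota : E -> U)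
    (F : E -> E) : set U :=
  [set w | ext_range iota F w /\ 0 <= w].

Definition ext_range_le0 {R : realType} {E U : rieszType R} (iota : E -> U)
    (F : E -> E) : set U :=
  [set w | ext_range iota F w /\ w <= 0].

Definition order_ideal {R : realType} {V : rieszType R} (J : set V) : Prop :=
  [/\ J 0,
      forall (a : R) x y, J x -> J y -> J (a *: x + y) &
      forall x y, J y -> rabs x <= rabs y -> J x].

Definition ideal_generated {R : realType} {V : rieszType R} (A : set V) :
    set V :=
  [set x | forall J : set V, order_ideal J -> A `<=` J -> J x].

Definition Linfty {R : realType} {E U : rieszType R} (iota : E -> U)
    (F : E -> E) : set U :=
  ideal_generated (ext_range iota F).

(* For f in Linfty iota F the extremum exists in U; otherwise the value is
   unspecified. *)
Definition cond_M {R : realType} {E U : rieszType R} (iota : E -> U)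
    (F : E -> E) (f : U) : U :=
  infimum 0 [set g | ext_range iota F g /\ f <= g].

Definition cond_m {R : realType} {E U : rieszType R} (iota : E -> U)
    (F : E -> E) (f : U) : U :=
  supremum 0 [set g | ext_range iota F g /\ g <= f].

(* Families indexed by times are functions on nat; only the values at times
   0, ..., T are constrained and used. *)
Definition filtration {R : realType} {E : rieszType R} (e : E) (T : nat)
    (F : nat -> E -> E) : Prop :=
  (forall t, (t <= T)%N -> conditional_expectation e (F t)) /\
  (forall i j, (i < j <= T)%N -> forall x,
     F i (F j x) = F i x /\ F j (F i x) = F i x).

Definition price_process {R : realType} {E U : rieszType R} (iota : E -> U)
    (T : nat) (F : nat -> E -> E) (S : nat -> U) : Prop :=
  [/\ forall t, (t <= T)%N -> ext_range iota (F t) (S t),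
      forall t, (t <= T)%N -> 0 <= S t &
      forall t, (t < T)%N -> Linfty iota (F t) (S t.+1)].

Definition gains {R : realType} {E : rieszType R} {U : fAlgType R}
    (iota : E -> U) (T : nat) (F : nat -> E -> E) (S : nat -> U) (t : nat) :
    set U :=
  [set v | exists2 theta : nat -> U,
     forall i, (t <= i < T)%N -> ext_range iota (F i) (theta i) &
     v = \sum_(t.+1 <= i < T.+1) theta i.-1 * (S i - S i.-1)].

Definition super_hedging_prices {R : realType} {E : rieszType R}
    {U : fAlgType R} (iota : E -> U) (T : nat) (F : nat -> E -> E)
    (S : nat -> U) (t : nat) : set U :=
  [set p | ext_range iota (F t) p /\
           exists2 v, gains iota T F S t v & 0 <= p + v].

Definition AIP {R : realType} {E : rieszType R} {U : fAlgType R}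
    (iota : E -> U) (T : nat) (F : nat -> E -> E) (S : nat -> U) : Prop :=
  forall t, (t < T)%N ->
    super_hedging_prices iota T F S t `&` ext_range_le0 iota (F t) = [set 0].

Definition NA {R : realType} {E : rieszType R} {U : fAlgType R}
    (iota : E -> U) (T : nat) (F : nat -> E -> E) (S : nat -> U) : Prop :=
  forall t, (t <= T)%N ->
    gains iota T F S t `&` ext_range_ge0 iota (F T) = [set 0].

(* Main.v *)
(* Let C be the range of the extended F_t. If h in C is nonnegative and
   h (S_{t+1} - S_t) >= 0, let p in C be the indicator of {h > 0}. Then
   p S_{t+1} >= p S_t, so p S_t is an element of C below S_{t+1}; hence
   p S_t <= m(S_{t+1}) and p (S_t - m(S_{t+1})) <= 0, and the spread condition
   forces p = 0, i.e. h = 0. Symmetrically for M. So a one-step gain which is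
   nonnegative comes from a zero strategy, and V + theta (S_{t+1} - S_t) >= 0
   with V, theta in C gives V >= 0 (multiply by the negative part of V).
   Backward induction on time shows that all intermediate values of a
   nonnegative terminal position are nonnegative, so the spread condition alone
   yields both AIP and NA.

   C is the set of u in the universal completion all of whose truncations
   (u /\ a) \/ -b are in F_t(E). This set is closed under suprema and infima,
   hence under sums (approximate both terms by truncations), and under squares,
   since u^2 = sup_q (2 q u - q^2), hence under products. *)
Require Import Defs.
From HB Require Import structures.
From mathcomp Require Import all_boot all_order all_algebra.
From mathcomp Require Import boolp classical_sets functions reals.
From mathcomp Require Import ring.
Set Implicit Arguments.
Unset Strict Implicit.
Unset Printing Implicit Defensive.

Import Order.TTheory GRing.Theory Num.Theory.
Local Open Scope classical_set_scope.
Local Open Scope ring_scope.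

(** * Order and lattice operations in Riesz spaces *)

Section RieszOrder.
Context {R : realType} {V : rieszType R}.
Implicit Types (x y z : V) (a b : R) (B : set V).

Lemma rler_D2r z x y : (x + z <= y + z) = (x <= y).
Proof.
apply/idP/idP => [h|]; last exact: riesz_lerD2r.
by move: (riesz_lerD2r (- z) _ _ h); rewrite !addrK.
Qed.

Lemma rler_D2l z x y : (z + x <= z + y) = (x <= y).
Proof. by rewrite ![z + _]addrC rler_D2r. Qed.

Lemma rlerD x y z t : x <= y -> z <= t -> x + z <= y + t.
Proof.
by move=> xy zt; apply: (@le_trans _ _ (y + z)); rewrite ?rler_D2r ?rler_D2l.
Qed.

Lemma rsubr_ge0 x y : (0 <= y - x) = (x <= y).
Proof. by rewrite -[LHS](rler_D2r x) add0r subrK. Qed.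

Lemma rsubr_le0 x y : (y - x <= 0) = (y <= x).
Proof. by rewrite -[LHS](rler_D2r x) add0r subrK. Qed.

Lemma rlerBlDr x y z : (x - y <= z) = (x <= z + y).
Proof. by rewrite -[LHS](rler_D2r y) subrK. Qed.

Lemma rlerBrDr x y z : (x <= y - z) = (x + z <= y).
Proof. by rewrite -[LHS](rler_D2r z) subrK. Qed.

Lemma rlerN2 x y : (- x <= - y) = (y <= x).
Proof. by rewrite -[LHS]rsubr_ge0 opprK addrC rsubr_ge0. Qed.

Lemma rlerNr x y : (x <= - y) = (y <= - x).
Proof. by rewrite -[RHS]rlerN2 opprK. Qed.

Lemma rlerNl x y : (- x <= y) = (- y <= x).
Proof. by rewrite -[RHS]rlerN2 opprK. Qed.

Lemma raddr_ge0 x y : 0 <= x -> 0 <= y -> 0 <= x + y.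
Proof. by move=> x0 y0; rewrite -[0](addr0 0) rlerD. Qed.

Lemma rler_wpZ2l a x y : 0 <= a -> x <= y -> a *: x <= a *: y.
Proof.
by move=> a0 xy; rewrite -rsubr_ge0 -scalerBr riesz_scaler_ge0 ?rsubr_ge0.
Qed.

Lemma rler_pZ2l a x y : 0 < a -> (a *: x <= a *: y) = (x <= y).
Proof.
move=> a0; apply/idP/idP; last exact/rler_wpZ2l/ltW.
move=> /(rler_wpZ2l (_ : 0 <= a^-1)); rewrite invr_ge0 ltW //.
by rewrite !scalerA mulVf ?gt_eqF // !scale1r; apply.
Qed.

Lemma raddrUl z x y : ((x `|` y) + z = (x + z) `|` (y + z))%O.
Proof.
apply/le_anti/andP; split; last first.
  by rewrite leUx !rler_D2r leUl leUr.
by rewrite -rlerBrDr leUx !rlerBrDr leUl leUr.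
Qed.

Lemma roppU x y : (- (x `|` y) = (- x) `&` (- y))%O.
Proof.
apply/le_anti/andP; split; first by rewrite lexI !rlerN2 leUl leUr.
by rewrite rlerNr leUx (rlerNr x) (rlerNr y) leIl leIr.
Qed.

Lemma roppI x y : (- (x `&` y) = (- x) `|` (- y))%O.
Proof. by rewrite -[RHS]opprK roppU !opprK. Qed.

Lemma raddrIl z x y : ((x `&` y) + z = (x + z) `&` (y + z))%O.
Proof.
by apply: oppr_inj; rewrite opprD !roppI raddrUl !opprD.
Qed.

Lemma raddUI x y : ((x `|` y) + (x `&` y) = x + y)%O.
Proof.
apply: (addIr (- (x `&` y)%O)); rewrite addrK roppI addrC raddrUl.
by rewrite addKr addrA addrAC addNr add0r joinC.
Qed.


Lemma sup_addr B s z : supremums B s ->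
  supremums [set b + z | b in B] (s + z).
Proof.
move=> [ub lub]; split=> [_ [b Bb <-]|v vub]; first by rewrite rler_D2r ub.
rewrite -rlerBrDr; apply: lub => b Bb; rewrite rlerBrDr.
by apply: vub; exists b.
Qed.

Lemma sup_scale B s a : 0 < a -> supremums B s ->
  supremums [set a *: b | b in B] (a *: s).
Proof.
move=> a0 [ub lub]; split=> [_ [b Bb <-]|v vub].
  by apply: rler_wpZ2l (ub _ Bb); exact: ltW.
rewrite -(scale1r v) -(mulfV (lt0r_neq0 a0)) -scalerA rler_pZ2l //.
apply: lub => b Bb.
rewrite -(rler_pZ2l _ _ a0) scalerA mulfV ?gt_eqF // scale1r.
by apply: vub; exists b.
Qed.

(** Since x + z is the join plus the meet of x and z, every b in [B] is at most v - z + (s \/ z) as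
    soon as v bounds the meets; the same bound for s turns back into s /\ z <= v. *)
Lemma sup_meet B s z : supremums B s ->
  supremums [set (b `&` z)%O | b in B] (s `&` z)%O.
Proof.
move=> [ub lub]; split=> [_ [b Bb <-]|v vub].
  by rewrite leI2 ?ub.
suff : s <= v - z + (s `|` z)%O.
  by rewrite addrAC rlerBrDr -raddUI [X in X <= _]addrC rler_D2r.
apply: lub => b Bb; rewrite addrAC rlerBrDr -raddUI [X in X <= _]addrC.
by apply: rlerD; [apply: vub; exists b | rewrite leU2 ?ub].
Qed.

Lemma sup_join B s z : B !=set0 -> supremums B s ->
  supremums [set (b `|` z)%O | b in B] (s `|` z)%O.
Proof.
move=> [b0 Bb0] [ub lub]; split=> [_ [b Bb <-]|v vub].
  by rewrite leU2 ?ub.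
have vb x : B x -> (x `|` z)%O <= v by move=> Bx; apply: vub; exists x.
rewrite leUx; apply/andP; split.
  by apply: lub => b /vb; apply: le_trans; rewrite leUl.
by apply: le_trans (vb _ Bb0); rewrite leUr.
Qed.

Lemma sup_opp B s : infimums B s -> supremums [set - b | b in B] (- s).
Proof.
move=> [lb glb]; split=> [_ [b Bb <-]|v vub]; first by rewrite rlerN2 lb.
by rewrite rlerNl; apply: glb => b Bb; rewrite rlerNl; apply: vub; exists b.
Qed.

Lemma inf_opp B s : supremums B s -> infimums [set - b | b in B] (- s).
Proof.
move=> [lb glb]; split=> [_ [b Bb <-]|v vub]; first by rewrite rlerN2 lb.
by rewrite rlerNr; apply: glb => b Bb; rewrite rlerNr; apply: vub; exists b.
Qed.

Lemma sup_pair x y : supremums [set x; y] (x `|` y)%O.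
Proof.
split=> [_ [->|->]|v vub]; rewrite ?leUl ?leUr //.
by rewrite leUx !vub //; [right|left].
Qed.

Lemma rmeetUl x y z : ((x `|` y) `&` z = (x `&` z) `|` (y `&` z))%O.
Proof.
have [ub lub] := sup_meet z (sup_pair x y).
apply/le_anti/andP; split; last by rewrite leUx !leI2 ?leUl ?leUr.
by apply: lub => _ [b [->|->] <-]; rewrite ?leUl ?leUr.
Qed.

Lemma rmeetUr x y z : (z `&` (x `|` y) = (z `&` x) `|` (z `&` y))%O.
Proof. by rewrite ![(z `&` _)%O]meetC rmeetUl. Qed.

Lemma rpos_ge0 x : 0 <= rpos x. Proof. exact: leUr. Qed.
Lemma rneg_ge0 x : 0 <= rneg x. Proof. exact: leUr. Qed.
Lemma rpos_ge x : x <= rpos x. Proof. exact: leUl. Qed.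
Lemma ler_rpos x y : x <= y -> rpos x <= rpos y.
Proof. by move=> xy; rewrite leU2. Qed.
Lemma rnegE x : rneg x = rpos (- x). Proof. by []. Qed.

Lemma rpos_sub_self x : rpos x - x = rneg x.
Proof. by rewrite /rpos raddrUl subrr sub0r joinC. Qed.

Lemma rpos_sub_rneg x : rpos x - rneg x = x.
Proof. by rewrite -rpos_sub_self opprB addrC subrK. Qed.

Lemma rpos_meet x : (rpos x `&` rneg x)%O = 0.
Proof.
apply: (addIr (- rneg x)).
rewrite raddrIl rpos_sub_rneg subrr sub0r.
by rewrite -[RHS]/(- (- x `|` 0)%O) roppU opprK oppr0.
Qed.

Lemma rneg_eq0 x : rneg x = 0 -> 0 <= x.
Proof. by move=> x0; rewrite -(rpos_sub_rneg x) x0 subr0 rpos_ge0. Qed.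

Lemma rpos_subE x y : rpos (x - y) = x - (x `&` y)%O.
Proof. by rewrite roppI [RHS]addrC raddrUl addNr joinC addrC. Qed.

End RieszOrder.

(** * Truncations by a weak order unit *)

Definition archimedean {R : realType} (V : rieszType R) : Prop :=
  forall d u : V, (forall n : nat, d *+ n <= u) -> d <= 0.

Lemma dedekind_complete_sup {R : realType} {V : rieszType R} (B : set V) u :
  dedekind_complete V -> B !=set0 -> ubound B u -> exists s, supremums B s.
Proof.
move=> DV B0 Bu.
have [|s [[_ ub] lub]] := DV B (subsetT _) B0; first by exists u.
by exists s; split=> // v vub; apply: lub.
Qed.

Lemma dedekind_complete_inf {R : realType} {V : rieszType R} (B : set V) u :
  dedekind_complete V -> B !=set0 -> lbound B u -> exists s, infimums B s.
Proof.
move=> DV [b0 Bb0] Bu.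
have [||s sup_s] := @dedekind_complete_sup _ _ [set - b | b in B] (- u) DV.
- by exists (- b0), b0.
- by move=> _ [b Bb <-]; rewrite rlerN2; apply: Bu.
exists (- s); have := inf_opp sup_s; congr (infimums _ _).
apply/seteqP; split=> [_ [_ [b Bb <-] <-]|b Bb]; first by rewrite opprK.
by exists (- b); rewrite ?opprK //; exists b.
Qed.

Lemma dedekind_complete_archimedean {R : realType} {V : rieszType R} :
  dedekind_complete V -> archimedean V.
Proof.
move=> DV d u ub_u.
have [||s [ub lub]] :=
  @dedekind_complete_sup _ _ (range (fun n : nat => d *+ n)) u DV.
- by exists (d *+ 0), 0%N.
- by move=> _ [n _ <-].
suff : s <= s - d by rewrite rlerBrDr -[X in _ <= X]addr0 rler_D2l.
apply: lub => _ [n _ <-]; rewrite rlerBrDr -mulrSr.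
by apply: ub; exists n.+1.
Qed.

Section Truncation.
Context {R : realType} {V : rieszType R} (e : V).
Hypothesis archV : archimedean V.
Hypothesis e_unit : weak_order_unit e.
Implicit Types (u v w d : V) (a b k : R) (B C Q : set V).

Let e_ge0 : 0 <= e. Proof. by case: e_unit. Qed.

Lemma unit_disjoint_eq0 u : 0 <= u -> (u `&` e)%O = 0 -> u = 0.
Proof.
move=> u0 ue; apply: (proj2 e_unit); rewrite /rabs.
by rewrite join_l //; apply: le_trans (u0); rewrite rlerNl oppr0.
Qed.

(** In other words inf_n (v - n e)^+ = 0. All multiples of d' = d^+ /\ e stay below v^+, so the
    archimedean property kills d', and the weak unit then kills d^+. *)
Lemma unit_excess_le0 v d : (forall n, d <= rpos (v - e *+ n)) -> d <= 0.
Proof.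
move=> dle; set d' := (rpos d `&` e)%O.
have d'_ge0 : 0 <= d' by rewrite lexI rpos_ge0.
have d'_le n : d' <= rpos (rpos v - e *+ n).
  apply: (@le_trans _ _ (rpos d)); first exact: leIl.
  rewrite leUx rpos_ge0 andbT; apply: le_trans (dle n) _.
  by apply: ler_rpos; rewrite rler_D2r rpos_ge.
(* Adding d' <= v^+ - v^+ /\ ne to v^+ /\ ne stays below v^+, so d' can be
   added again and again. *)
have d'n n : d' *+ n <= (rpos v `&` (e *+ n))%O.
  elim: n => [|n IH]; first by rewrite !mulr0n lexI rpos_ge0 lexx.
  rewrite mulrSr lexI; apply/andP; split.
    have := rlerD IH (d'_le n); rewrite rpos_subE.
    by rewrite [X in _ <= X]addrC subrK.
  rewrite mulrSr; apply: rlerD; last exact: leIr.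
  by apply: le_trans IH _; exact: leIr.
have d'_le0 : d' <= 0.
  by apply: (archV (u := rpos v)) => n; apply: le_trans (d'n n) (leIl _ _).
have /(unit_disjoint_eq0 (rpos_ge0 _)) <- : d' = 0 by apply/le_anti/andP.
exact: rpos_ge.
Qed.

(** An upper bound w of the truncations satisfies v - w <= v - v /\ n e = (v - n e)^+ for every
    n. *)
Lemma sup_truncations v : supremums (range (fun n => v `&` (e *+ n))%O) v.
Proof.
split=> [_ [n _ <-]|w wub]; first exact: leIl.
rewrite -rsubr_le0; apply: (@unit_excess_le0 v) => n.
by rewrite rpos_subE rler_D2l rlerN2; apply: wub; exists n.
Qed.

Definition clamp a b u : V := ((u `&` (a *: e)) `|` - (b *: e))%O.

Lemma clampN a b u : 0 <= a -> 0 <= b -> clamp a b (- u) = - clamp b a u.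
Proof.
move=> a0 b0; rewrite /clamp roppU roppI opprK rmeetUl.
congr (_ `|` _)%O; apply/esym/meet_idPl.
apply: (@le_trans _ _ 0); last exact: riesz_scaler_ge0.
by rewrite rlerNl oppr0 riesz_scaler_ge0.
Qed.

Definition sup_closed C :=
  forall B s, B `<=` C -> B !=set0 -> supremums B s -> C s.

Definition inf_closed C :=
  forall B s, B `<=` C -> B !=set0 -> infimums B s -> C s.

(** v is the supremum over n of v /\ n e, and each of these is the infimum over m of its joins with
    -m e, which are clamps of v. *)
Lemma sup_inf_closed_clamp Q v : sup_closed Q -> inf_closed Q ->
  (forall a b, 0 <= a -> 0 <= b -> Q (clamp a b v)) -> Q v.
Proof.
move=> Qs Qi Qv.
apply: (Qs) (sup_truncations v); last by eexists; exists 0%N.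
move=> _ [n _ <-].
have := inf_opp (sup_truncations (- (v `&` (e *+ n))%O)); rewrite opprK.
apply: Qi; last by eexists; eexists; [exists 0%N|].
move=> _ [_ [m _ <-] <-].
by rewrite roppI opprK -!scaler_nat; apply: Qv.
Qed.


(** * Elements whose truncations lie in a given Riesz subspace *)

Definition clamp_hull (A : set V) : set V :=
  [set u | forall a b, 0 <= a -> 0 <= b -> A (clamp a b u)].

Lemma clamp_le a b u : 0 <= a -> 0 <= b -> clamp a b u <= a *: e.
Proof.
move=> a0 b0; rewrite leUx leIr /=; apply: (@le_trans _ _ 0).
  by rewrite rlerNl oppr0 riesz_scaler_ge0.
exact: riesz_scaler_ge0.
Qed.

Lemma clampZ k a b u : 0 < k ->
  clamp a b (k *: u) = k *: clamp (k^-1 * a) (k^-1 * b) u.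
Proof.
move=> k0; have kK c : k * (k^-1 * c) = c.
  by rewrite mulrA mulfV ?mul1r ?lt0r_neq0.
have scaleU (x y : V) : k *: (x `|` y)%O = ((k *: x) `|` (k *: y))%O.
  apply: (is_subset1_supremums (A := [set k *: x; k *: y])).
    have := sup_scale k0 (sup_pair x y); congr (supremums _ _).
    apply/seteqP; split=> [_ [z [->|->] <-]|z [->|->]]; [by left|by right| |].
      by exists x; [left|].
    by exists y; [right|].
  exact: sup_pair.
have scaleI (x y : V) : k *: (x `&` y)%O = ((k *: x) `&` (k *: y))%O.
  by apply: oppr_inj; rewrite -scalerN !roppI scaleU !scalerN.
by rewrite /clamp scaleU scaleI scalerN !scalerA !kK.
Qed.

Section ClampHull.
Variable A : set V.
Hypothesis A_riesz : riesz_subspace A.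
Hypothesis A_unit : A e.
(** In the application [A] sits inside the image of E while suprema are taken in the universal
    completion, so a supremum that no multiple of [e] dominates may leave [A]. *)
Hypothesis A_sup : forall B s a, B `<=` A -> B !=set0 -> supremums B s ->
  s <= a *: e -> A s.

Local Notation C := (clamp_hull A).

Let A0 : A 0. Proof. by case: A_riesz. Qed.
Let AZD a x y : A x -> A y -> A (a *: x + y).
Proof. by case: A_riesz => _ + _ _; apply. Qed.
Let AZ a x : A x -> A (a *: x).
Proof. by move=> Ax; rewrite -[_ *: _]addr0; apply: AZD. Qed.
Let AN x : A x -> A (- x).
Proof. by rewrite -scaleN1r; apply: AZ. Qed.
Let AU x y : A x -> A y -> A (x `|` y)%O.
Proof. by case: A_riesz => _ _ + _; apply. Qed.
Let AI x y : A x -> A y -> A (x `&` y)%O.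
Proof. by case: A_riesz => _ _ _; apply. Qed.

Lemma clamp_hull_opp u : C u -> C (- u).
Proof. by move=> Cu a b a0 b0; rewrite clampN //; apply/AN/Cu. Qed.

(** Meeting with a e and joining with -b e commute with suprema, and the clamp of s is at most a e,
    so [A_sup] applies to the clamps. *)
Lemma clamp_hull_sup : sup_closed C.
Proof.
move=> B s BC B0 sup_s a b a0 b0.
have B1 : [set (x `&` (a *: e))%O | x in B] !=set0.
  by case: B0 => x Bx; exists (x `&` (a *: e))%O, x.
apply: A_sup (sup_join (- (b *: e)) B1 (sup_meet (a *: e) sup_s)) _.
- by move=> _ [_ [x Bx <-] <-]; apply: BC.
- by case: B1 => x Bx; exists (x `|` - (b *: e))%O, x.
exact: clamp_le.
Qed.

Lemma sub_clamp_hull : A `<=` C.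
Proof. by move=> x Ax a b _ _; apply: AU; [apply: AI|apply: AN]; auto. Qed.

Lemma clamp_hull_bounded u a b : 0 <= a -> 0 <= b ->
  u <= a *: e -> - (b *: e) <= u -> C u -> A u.
Proof.
move=> a0 b0 ua ub /(_ a b a0 b0); congr A.
by rewrite /clamp meet_l // join_l.
Qed.

Lemma clamp_hullZ k u : C u -> C (k *: u).
Proof.
move=> Cu; have pos c : 0 < c -> C (c *: u).
  move=> c0 a b a0 b0; rewrite clampZ //; apply/AZ/Cu.
    by rewrite mulr_ge0 ?invr_ge0 // ltW.
  by rewrite mulr_ge0 ?invr_ge0 // ltW.
have [k0|k0|->] := ltgtP k 0; last by rewrite scale0r; apply: sub_clamp_hull.
  rewrite -(opprK (k *: u)) -scaleNr; apply/clamp_hull_opp/pos.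
  by rewrite oppr_gt0.
exact: pos.
Qed.

Lemma sup_inf_closed_translate u :
  sup_closed [set v | C (u + v)] /\ inf_closed [set v | C (u + v)].
Proof.
split=> B s BQ [b0 Bb0] lim_s /=.
  have := sup_addr u lim_s; rewrite addrC; apply: clamp_hull_sup.
    by move=> _ [x Bx <-]; rewrite addrC; apply: BQ.
  by exists (b0 + u), b0.
rewrite -(opprK (u + s)) opprD addrC; apply: clamp_hull_opp.
apply: clamp_hull_sup (sup_addr (- u) (sup_opp lim_s)).
  move=> _ [_ [x Bx <-] <-]; rewrite -opprD addrC; apply/clamp_hull_opp/BQ.
  exact: Bx.
by exists (- b0 - u), (- b0) => //; exists b0.
Qed.

(** Two passes of [sup_inf_closed_clamp]: for x in [A] and y in the hull, y is replaced by its
    clamps, so that both terms lie in [A]; for two elements of the hull, one is then replaced by its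
    clamps. *)
Lemma clamp_hullD u v : C u -> C v -> C (u + v).
Proof.
have AC x y : A x -> C y -> C (x + y).
  move=> Ax Cy; have [Qs Qi] := sup_inf_closed_translate x.
  apply: (sup_inf_closed_clamp Qs Qi) => a b a0 b0; apply: sub_clamp_hull.
  by rewrite -[x]scale1r; apply: AZD; [|apply: Cy].
move=> Cu Cv; have [Qs Qi] := sup_inf_closed_translate v.
rewrite addrC; apply: (sup_inf_closed_clamp Qs Qi) => a b a0 b0.
by rewrite /= addrC; apply: AC => //; apply: Cu.
Qed.

Lemma clamp_hull_join u v : C u -> C v -> C (u `|` v)%O.
Proof.
move=> Cu Cv; apply: clamp_hull_sup (sup_pair u v).
  by move=> _ [->|->].
by exists u; left.
Qed.

Lemma clamp_hull_meet u v : C u -> C v -> C (u `&` v)%O.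
Proof.
move=> Cu Cv; rewrite -(opprK (u `&` v)%O) roppI.
by apply/clamp_hull_opp/clamp_hull_join; apply: clamp_hull_opp.
Qed.

End ClampHull.
End Truncation.

(** * Products and squares in f-algebras *)

Section FAlgebraTheory.
Context {R : realType} {U : fAlgType R}.
Implicit Types (x y z d : U) (a b q : R).

Lemma rmulr_ge0 x y : 0 <= x -> 0 <= y -> 0 <= x * y.
Proof. exact: falg_mul_ge0. Qed.

Lemma rscalerAl a x y : a *: (x * y) = (a *: x) * y.
Proof. exact: falg_scaleAl. Qed.

Lemma meet_mull_eq0 x y z : 0 <= z -> (x `&` y)%O = 0 -> (z * x `&` y)%O = 0.
Proof. exact: falg_meet_mull. Qed.

(** Using the f-algebra axiom once in each factor makes x y disjoint from itself. *)
Lemma disjoint_mul_eq0 x y : (x `&` y)%O = 0 -> x * y = 0.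
Proof.
move=> xy; have x0 : 0 <= x by rewrite -xy leIl.
have y0 : 0 <= y by rewrite -xy leIr.
have := meet_mull_eq0 y0 xy; rewrite meetC => /(meet_mull_eq0 x0).
by rewrite [y * x]mulrC meetxx.
Qed.

Lemma rpos_rneg_mul x : rpos x * rneg x = 0.
Proof. exact/disjoint_mul_eq0/rpos_meet. Qed.

Lemma rpos_mul x : rpos x * x = rpos x * rpos x.
Proof.
have := congr1 (fun z => rpos x * z) (rpos_sub_rneg x).
by rewrite mulrBr rpos_rneg_mul subr0.
Qed.

Lemma rneg_mul x : rneg x * x = - (rneg x * rneg x).
Proof.
have := congr1 (fun z => rneg x * z) (rpos_sub_rneg x).
by rewrite mulrBr [rneg x * rpos x]mulrC rpos_rneg_mul sub0r.
Qed.

Lemma rsqrE x : x * x = rpos x * rpos x + rneg x * rneg x.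
Proof.
rewrite -{1 2}(rpos_sub_rneg x) mulrBl !mulrBr [rneg x * rpos x]mulrC.
rewrite rpos_rneg_mul.
by rewrite subr0 sub0r opprK.
Qed.

Lemma rsqr_ge0 x : 0 <= x * x.
Proof.
rewrite rsqrE; apply: raddr_ge0; apply: rmulr_ge0;
  by rewrite ?rpos_ge0 ?rneg_ge0.
Qed.

Lemma rone_ge0 : 0 <= 1 :> U.
Proof. by rewrite -[1]mulr1; apply: rsqr_ge0. Qed.

Lemma rabs_ge0 x : 0 <= rabs x.
Proof.
rewrite -(rler_pZ2l _ _ (ltr0n R 2)) scaler0 scaler_nat mulr2n.
by rewrite -(subrr x) rlerD // /rabs ?leUl ?leUr.
Qed.

(** If |x| and 1 are disjoint, multiplying 1 by |x| makes |x| disjoint from itself. *)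
Lemma one_weak_order_unit : weak_order_unit (1 : U).
Proof.
split=> [|x x1]; first exact: rone_ge0.
have := meet_mull_eq0 (rabs_ge0 x) (etrans (meetC _ _) x1).
rewrite mulr1 meetxx => x0; apply/le_anti/andP; split.
  by rewrite -x0 leUl.
by rewrite -[x]opprK rlerNr oppr0 -x0 leUr.
Qed.

(** For y >= 0 the elements x^+ y and x^- y remain disjoint, and their difference is x y. *)
Lemma rposM x y : 0 <= y -> rpos (x * y) = rpos x * y.
Proof.
move=> y0; rewrite -{1}(rpos_sub_rneg x) mulrBl rpos_subE.
have := meet_mull_eq0 y0 (rpos_meet x).
rewrite meetC => /(meet_mull_eq0 y0); rewrite meetC mulrC [y * rneg x]mulrC.
by move=> ->; rewrite subr0.
Qed.

Lemma rnegM x y : 0 <= y -> rneg (x * y) = rneg x * y.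
Proof. by move=> y0; rewrite !rnegE -mulNr rposM. Qed.

Lemma rler_wpM2l x y z : 0 <= x -> y <= z -> x * y <= x * z.
Proof. by move=> x0 yz; rewrite -rsubr_ge0 -mulrBr rmulr_ge0 ?rsubr_ge0. Qed.

Lemma rler_wpM2r x y z : 0 <= x -> y <= z -> y * x <= z * x.
Proof. by rewrite ![_ * x]mulrC; apply: rler_wpM2l. Qed.

Hypothesis archU : archimedean U.

(** If y^2 = 0 then 0 <= (1 - n y)^2 = 1 - 2 n y for every n, and the archimedean property gives y
    <= 0. This is applied to x and to -x. *)
Lemma rsqr_eq0 x : x * x = 0 -> x = 0.
Proof.
have le0 y : y * y = 0 -> y <= 0.
  move=> yy; rewrite -(rler_pZ2l _ _ (ltr0n R 2)) scaler0 scaler_nat.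
  apply: (archU (u := 1)) => n; rewrite -rsubr_ge0.
  have := rsqr_ge0 (1 - y *+ n); congr (0 <= _).
  rewrite mulrBl mul1r mulrBr mulr1 mulrnAl mulrnAr yy !mul0rn subr0.
  by rewrite mulrnAC mulr2n opprD addrA.
move=> xx; apply/le_anti; rewrite le0 //=.
by rewrite -[x]opprK rlerNr oppr0; apply: le0; rewrite mulrNN.
Qed.

Lemma mul_eq0_disjoint x y : 0 <= x -> 0 <= y -> x * y = 0 -> (x `&` y)%O = 0.
Proof.
move=> x0 y0 xy; have m0 : 0 <= (x `&` y)%O by rewrite lexI x0.
apply: rsqr_eq0; apply/le_anti; rewrite rmulr_ge0 // andbT -xy.
apply: (@le_trans _ _ (x * (x `&` y)%O)).
  by apply: rler_wpM2r => //; apply: leIl.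
by apply: rler_wpM2l => //; apply: leIr.
Qed.

(** With p = (x - y)^+, the product p (x + y) is the positive part of x^2 - y^2, hence 0; as p <= x
    + y, also p^2 = 0. *)
Lemma ler_of_sqr x y : 0 <= x -> 0 <= y -> x * x <= y * y -> x <= y.
Proof.
move=> x0 y0 xy; set p := rpos (x - y).
have p0 : 0 <= p by exact: rpos_ge0.
have pxy : p * (x + y) = 0.
  rewrite -rposM ?raddr_ge0 //.
  have -> : (x - y) * (x + y) = x * x - y * y by ring.
  by rewrite /rpos join_r // rsubr_le0.
have px : p <= x + y.
  rewrite leUx raddr_ge0 // andbT rler_D2l.
  by apply: (@le_trans _ _ 0) => //; rewrite rlerNl oppr0.
have /rsqr_eq0 p_eq0 : p * p = 0.
  by apply/le_anti; rewrite rsqr_ge0 andbT -pxy; apply: rler_wpM2l.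
by rewrite -rsubr_le0 -p_eq0; apply: rpos_ge.
Qed.

Lemma rabs_sqr x : rabs x * rabs x = x * x.
Proof.
suff -> : rabs x = rpos x + rneg x.
  rewrite [RHS]rsqrE mulrDl !mulrDr [rneg x * rpos x]mulrC rpos_rneg_mul.
  by rewrite addr0 add0r.
rewrite -raddUI rpos_meet addr0 /rpos /rneg joinACA joinxx.
by rewrite join_l // rabs_ge0.
Qed.

End FAlgebraTheory.

(** Walking along the grid of step r: an element that keeps distance d from all grid points cannot
    be crossed unless d is at most r e. Letting n grow, [unit_excess_le0] will leave only d <= r
    e. *)
Lemma grid_distance {R : realType} {V : rieszType R} (e a d : V) (r : R) :
  0 <= e -> 0 <= a -> 0 <= r ->
  (forall q, 0 <= q -> d <= rabs (a - q *: e)) ->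
  forall n : nat, d <= ((r *: e) `|` (a - (r *+ n) *: e))%O.
Proof.
move=> e0 a0 r0 dle; elim=> [|n IH].
  have := dle 0 (lexx 0); rewrite mulr0n scale0r subr0 => /le_trans; apply.
  rewrite leUx leUr /=; apply: (@le_trans _ _ 0); first by rewrite rlerNl oppr0.
  by apply: le_trans a0 _; exact: leUr.
have := dle (r *+ n.+1) (mulrn_wge0 _ r0).
rewrite mulrSr scalerDl opprD addrA; move: IH.
set b := a - _; set s := r *: e => db dabs.
have s0 : 0 <= s by exact: riesz_scaler_ge0.
have : d <= ((s `|` b) `&` ((b - s) `|` (s - b)))%O.
  by rewrite lexI db; move: dabs; rewrite /rabs opprB.
move/le_trans; apply; rewrite rmeetUl leUx; apply/andP; split.
  by apply: le_trans (leIl _ _) _; rewrite leUl.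
rewrite rmeetUr leUx; apply/andP; split.
  by apply: le_trans (leIr _ _) _; rewrite leUr.
(* Twice the meet of b and s - b is at most their sum s. *)
apply: (@le_trans _ _ s); last exact: leUl.
rewrite -(rler_pZ2l _ _ (ltr0n R 2)) !scaler_nat !mulr2n.
apply: (@le_trans _ _ (b + (s - b))); first by rewrite rlerD ?leIl ?leIr.
by rewrite addrC subrK -[X in X <= _]addr0 rler_D2l.
Qed.

Section SquareApproximation.
Context {R : realType} {U : fAlgType R}.
Hypothesis archU : archimedean U.
Implicit Types (a d w : U) (q r : R) (C : set U).

(** The members of the family are a^2 - (a - q)^2. For an upper bound w, d = (a^2 - w)^+ /\ 1 has
    d^2 <= d <= (a - q)^2, so d <= |a - q| for every real q, which forces d = 0. *)
Lemma sqr_sup a : 0 <= a ->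
  supremums (range (fun q =>
    (q *: (1 : U)) * a *+ 2 - (q *: (1 : U)) * (q *: (1 : U)))) (a * a).
Proof.
move=> a0; have one0 := @rone_ge0 R U.
have sqE q : (a - q *: (1 : U)) * (a - q *: (1 : U)) =
  a * a - ((q *: (1 : U)) * a *+ 2 - (q *: (1 : U)) * (q *: (1 : U))) by ring.
split=> [_ [q _ <-]|w wub].
  by rewrite -rsubr_ge0 -sqE; apply: rsqr_ge0.
set d := (rpos (a * a - w) `&` 1)%O.
have d0 : 0 <= d by rewrite lexI rpos_ge0.
have dabs q : d <= rabs (a - q *: (1 : U)).
  apply: ler_of_sqr => //; first exact: rabs_ge0.
  apply: (@le_trans _ _ d).
    by rewrite -[X in _ <= X]mulr1 rler_wpM2l // leIr.
  rewrite rabs_sqr; apply: le_trans (leIl _ _) _.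
  rewrite leUx rsqr_ge0 andbT sqE rler_D2l rlerN2; apply: wub.
  by exists q.
have d_le k : d <= k.+1%:R^-1 *: (1 : U).
  have k0 : 0 <= k.+1%:R^-1 :> R by rewrite invr_ge0.
  rewrite -rsubr_le0.
  apply: (unit_excess_le0 archU one_weak_order_unit (v := a)) => n.
  (* After (k+1) n steps of length 1/(k+1) the grid point is n, so d - 1/(k+1) <= (a - n)^+. *)
  have := grid_distance one0 a0 k0 (fun q _ => dabs q) (k.+1 * n)%N.
  rewrite mulrnA -[_^-1 *+ _]mulr_natr mulVf ?pnatr_eq0 // scaler_nat.
  move=> /le_trans h; rewrite rlerBlDr; apply: h.
  rewrite leUx; apply/andP; split.
    by rewrite -[X in X <= _]add0r rler_D2r rpos_ge0.
  by rewrite -[X in X <= _]addr0 rlerD ?rpos_ge // riesz_scaler_ge0.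
have d_le0 : d <= 0.
  apply: (archU (u := 1)) => -[|n]; first by rewrite mulr0n.
  have := rler_wpZ2l (ler0n R n.+1) (d_le n).
  by rewrite scalerA mulfV ?pnatr_eq0 // scale1r scaler_nat.
rewrite -rsubr_le0.
have /(unit_disjoint_eq0 one_weak_order_unit (rpos_ge0 _)) <- : d = 0.
  by apply/le_anti/andP.
exact: rpos_ge.
Qed.

(** For a >= 0 the family of [sqr_sup] consists of linear combinations of a and 1, so a^2 is in [C].
    Positive and negative parts give all squares, and polarization gives products. *)
Lemma riesz_subspace_mul C : riesz_subspace C -> sup_closed C -> C 1 ->
  forall x y, C x -> C y -> C (x * y).
Proof.
move=> [C0 CZD CU CI] Cs C1.
have CD x y : C x -> C y -> C (x + y).
  by move=> Cx Cy; rewrite -[x]scale1r; apply: CZD.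
have CZ r x : C x -> C (r *: x).
  by move=> Cx; rewrite -[_ *: _]addr0; apply: CZD.
have CN x : C x -> C (- x) by rewrite -scaleN1r; apply: CZ.
have Csqr0 a : 0 <= a -> C a -> C (a * a).
  move=> a0 Ca; apply: Cs (sqr_sup a0); last by eexists; exists 0.
  move=> _ [q _ <-]; rewrite mulr2n -!rscalerAl !mul1r.
  by apply: (CD); [apply: CD; apply: CZ|apply/CN/CZ/CZ].
have Csqr x : C x -> C (x * x).
  move=> Cx; rewrite rsqrE.
  apply: CD; apply: Csqr0; rewrite ?rpos_ge0 ?rneg_ge0 //; apply: CU => //.
  exact: CN.
move=> x y Cx Cy.
have -> : x * y = 2^-1 *: (x * y *+ 2).
  by rewrite -scaler_nat scalerA mulVf ?pnatr_eq0 // scale1r.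
have -> : x * y *+ 2 = (x + y) * (x + y) + - (x * x) + - (y * y) by ring.
apply/CZ/(CD); last exact/CN/Csqr.
by apply: (CD); [exact/Csqr/CD|exact/CN/Csqr].
Qed.

End SquareApproximation.

Lemma clamp_hull_riesz {R : realType} {V : rieszType R} (e : V) (A : set V) :
  archimedean V -> weak_order_unit e -> riesz_subspace A -> A e ->
  (forall B s a, B `<=` A -> B !=set0 -> supremums B s -> s <= a *: e -> A s) ->
  riesz_subspace (clamp_hull e A).
Proof.
move=> archV e_unit A_riesz Ae A_sup; split.
- by apply: sub_clamp_hull => //; case: A_riesz.
- move=> a x y Cx Cy; apply: clamp_hullD => //; exact: clamp_hullZ.
- by move=> x y; apply: clamp_hull_join.
- by move=> x y; apply: clamp_hull_meet.
Qed.

(** * The range of an extended conditional expectation *)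

Section LinearMaps.
Context {R : realType} {V W : rieszType R} (f : V -> W).
Hypothesis lin_f : linear f.

Lemma linear0 : f 0 = 0.
Proof.
have := lin_f 1 0 0; rewrite !scale1r addr0 => h.
by apply: (addrI (f 0)); rewrite -h addr0.
Qed.

Lemma linearD x y : f (x + y) = f x + f y.
Proof. by have := lin_f 1 x y; rewrite !scale1r. Qed.

Lemma linearZ a x : f (a *: x) = a *: f x.
Proof. by have := lin_f a x 0; rewrite linear0 !addr0. Qed.

Lemma linearN x : f (- x) = - f x.
Proof. by rewrite -scaleN1r linearZ scaleN1r. Qed.

Lemma linearB x y : f (x - y) = f x - f y.
Proof. by rewrite linearD linearN. Qed.

End LinearMaps.

Section ConditionalExpectation.
Context {R : realType} {E : rieszType R} (e : E) (F : E -> E).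
Hypothesis condF : conditional_expectation e F.

Let linF : linear F. Proof. by case: condF => -[]. Qed.
Let FF x : F (F x) = F x. Proof. by case: condF => -[]. Qed.
Let F_gt0 x : 0 < x -> 0 < F x. Proof. by case: condF => _ + _ _ _; apply. Qed.

Lemma cond_expectation_le x y : x <= y -> F x <= F y.
Proof.
rewrite -rsubr_ge0 -[F x <= F y]rsubr_ge0 -linearB // le_eqVlt.
by case/predU1P => [<-|/F_gt0/ltW //]; rewrite linear0.
Qed.

Lemma cond_expectation_range x : range F x -> F x = x.
Proof. by case=> y _ <-; exact: FF. Qed.

Lemma range_cond_expectation_unit : range F e.
Proof. by exists e => //; case: condF. Qed.

Lemma range_cond_expectation_sup (B : set E) s :
  B `<=` range F -> supremums B s -> range F s.
Proof.
move=> BF [ub lub]; exists s => //.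
(* F s is an upper bound as well; strict positivity applied to F s - s, which F
   maps to 0, then gives F s = s. *)
have sF : s <= F s.
  apply: lub => b Bb; rewrite -(cond_expectation_range (BF _ Bb)).
  by apply: cond_expectation_le; exact: ub.
apply/eqP; rewrite -subr_eq0; apply/negPn/negP => neq0.
have /F_gt0 : 0 < F s - s by rewrite lt_def neq0 rsubr_ge0.
by rewrite linearB // FF subrr ltxx.
Qed.

End ConditionalExpectation.

(** * Suprema under the embedding into the universal completion *)

Section UniversalCompletion.
Context {R : realType} {E U : rieszType R} (iota : E -> U).
Hypothesis U_completion : universal_completion iota.

Let iota_lin : linear iota. Proof. by case: U_completion => -[]. Qed.
Let iota_inj : injective iota. Proof. by case: U_completion. Qed.
Let iotaI x y : iota (x `&` y)%O = (iota x `&` iota y)%O.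
Proof. by case: U_completion => -[]. Qed.

Lemma ler_iota x y : (iota x <= iota y) = (x <= y).
Proof.
apply/idP/idP => /meet_idPl h; apply/meet_idPl; last by rewrite -iotaI h.
by apply: iota_inj; rewrite iotaI.
Qed.

(** If an upper bound v in U were not above iota s, order density would give x > 0 in E with iota x
    below the gap, and s - x would still bound [B]. *)
Lemma iota_sup (B : set E) s : supremums B s ->
  supremums (iota @` B) (iota s).
Proof.
move=> [ub lub]; split=> [_ [b Bb <-]|v vub]; first by rewrite ler_iota ub.
suff <- : (v `&` iota s)%O = iota s by exact: leIl.
apply/eqP; rewrite eq_sym -subr_eq0; apply/negPn/negP => neq0.
have pos : 0 < iota s - (v `&` iota s)%O by rewrite lt_def neq0 rsubr_ge0 leIr.
have [x []] : exists x, 0 < iota x /\ iota x <= iota s - (v `&` iota s)%O.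
  by case: U_completion => _ _ _; apply.
rewrite lt_def => /andP[/negP x_neq0 x_ge0] x_le; apply: x_neq0.
rewrite eq_le x_ge0 andbT -(linear0 iota_lin) ler_iota.
suff : s <= s - x by rewrite rlerBrDr -[X in _ <= X]addr0 rler_D2l.
apply: lub => b Bb; rewrite -ler_iota linearB // rlerBrDr.
rewrite addrC -rlerBrDr; apply: le_trans x_le _.
rewrite rler_D2l rlerN2 lexI ler_iota ub // andbT.
by apply: vub; exists b.
Qed.

End UniversalCompletion.

Section ExtendedRange.
Context {R : realType} {E : rieszType R} (e : E) {U : fAlgType R}.
Variable iota : E -> U.
Hypothesis E_complete : dedekind_complete E.
Hypothesis U_completion : universal_completion iota.
Hypothesis e_one : iota e = 1.

Let iota_lin : linear iota. Proof. by case: U_completion => -[]. Qed.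

Lemma completion_archimedean : archimedean U.
Proof.
by apply: dedekind_complete_archimedean; case: U_completion => _ _ [].
Qed.

Section OneExpectation.
Variable F : E -> E.
Hypothesis condF : conditional_expectation e F.

Local Notation A := (iota @` range F).

Lemma image_range_riesz : riesz_subspace A.
Proof.
have [[_ iotaU iotaI] _ _ _] := U_completion.
have [_ _ _ _ [[F0 FZD FU FI] _]] := condF; split.
- by exists 0; rewrite ?linear0.
- move=> a _ _ [x Fx <-] [y Fy <-]; exists (a *: x + y); first exact: FZD.
  by rewrite linearD // linearZ.
- by move=> _ _ [x Fx <-] [y Fy <-]; exists (x `|` y)%O; [exact: FU|].
- by move=> _ _ [x Fx <-] [y Fy <-]; exists (x `&` y)%O; [exact: FI|].
Qed.

Lemma image_range_unit : A 1.
Proof. by exists e => //; exact: range_cond_expectation_unit condF. Qed.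

(** The bound by a multiple of the unit allows the supremum to be taken in E, where it stays in the
    range of [F]; [iota] then preserves it. *)
Lemma image_range_sup (B : set U) s (a : R) :
  B `<=` A -> B !=set0 -> supremums B s ->
  s <= a *: (1 : U) -> A s.
Proof.
move=> BA [b0 Bb0] sup_s s_le.
pose B' := [set x | range F x /\ B (iota x)].
have B'B : iota @` B' = B.
  apply/seteqP; split=> [_ [x [_ Bx] <-] //|b Bb].
  by have [x Fx xb] := BA _ Bb; exists x => //; split; rewrite ?xb.
have [||y sup_y] := @dedekind_complete_sup _ _ B' (a *: e) E_complete.
- by have [x Fx xb] := BA _ Bb0; exists x; split; rewrite ?xb.
- move=> x [_ Bx]; rewrite -(ler_iota U_completion) linearZ // e_one.
  by apply: le_trans s_le; case: sup_s => + _; apply.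
exists y; first by apply: range_cond_expectation_sup condF _ _ _ sup_y => x [].
apply: is_subset1_supremums sup_s; rewrite -B'B.
exact: iota_sup sup_y.
Qed.

Local Notation C := (clamp_hull (1 : U) A).

Let archU := completion_archimedean.
Let unitU : weak_order_unit (1 : U) := one_weak_order_unit.

Lemma ext_pos_hull z w : ext_pos iota F z w -> C w.
Proof.
move=> [I [le [x [[[i] _ _ _] _ _ _ sup_w]]]].
apply: (clamp_hull_sup unitU image_range_sup) sup_w.
  move=> _ [j _ <-].
  apply: sub_clamp_hull image_range_riesz image_range_unit _ _.
  by exists (F (x j)) => //; exists (x j).
by exists (iota (F (x i))), i.
Qed.

(** The net is the sequence of truncations w /\ n. They come from elements fixed by [F], so the
    extension of [F] fixes w. *)
Lemma hull_ext_pos w : 0 <= w -> C w -> ext_pos iota F w w.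
Proof.
move=> w0 Cw.
have n0 n : 0 <= n%:R :> R by exact: ler0n.
have /choice [x xE] n : exists x, range F x /\ iota x = (w `&` (1 *+ n))%O.
  have [x Fx xE] := Cw _ _ (n0 n) (lexx 0).
  exists x; split=> //; rewrite xE /clamp scale0r oppr0 scaler_nat.
  by rewrite join_l // lexI w0 -scaler_nat riesz_scaler_ge0 //; exact: rone_ge0.
have Fx n : F (x n) = x n.
  by apply: (cond_expectation_range condF); case: (xE n).
have x_ge0 n : 0 <= x n.
  rewrite -(ler_iota U_completion) linear0 // (proj2 (xE n)) lexI w0 /=.
  by rewrite -scaler_nat riesz_scaler_ge0 //; exact: rone_ge0.
have sup_w : supremums (range (iota \o x)) w.
  rewrite (_ : iota \o x = fun n => w `&` (1 *+ n))%O.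
    exact: sup_truncations.
  by apply/funext => n /=; case: (xE n).
have FxE : iota \o F \o x = iota \o x by apply/funext => n /=; rewrite Fx.
exists nat, (fun m n => (m <= n)%N), x; rewrite FxE; split=> //.
- split=> [|||m n]; [exact: (inhabits 0%N)|exact: leqnn| |].
    by move=> a b c; exact: leq_trans.
  by exists (maxn m n); rewrite leq_maxl leq_maxr.
- split=> // m n mn /=; rewrite (proj2 (xE m)) (proj2 (xE n)) leI2 //.
  rewrite -rsubr_ge0 -mulrnBr // -scaler_nat riesz_scaler_ge0 //.
  exact: rone_ge0.
- split; last by exists w; case: sup_w.
  exists 0 => _ [n _ <-] /=.
  by rewrite -(linear0 iota_lin) (ler_iota U_completion).
Qed.

Lemma hull_riesz : riesz_subspace C.
Proof.
apply: clamp_hull_riesz => //; first exact: image_range_riesz.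
  exact: image_range_unit.
by move=> B s a; exact: image_range_sup.
Qed.

Lemma ext_rangeE : ext_range iota F = C.
Proof.
have [C0 CZD CU CI] := hull_riesz.
have CN x : C x -> C (- x).
  by move=> Cx; rewrite -scaleN1r -[_ *: _]addr0; apply: CZD.
apply/seteqP; split=> w.
  move=> [z [w1 [w2 [/ext_pos_hull C1 /ext_pos_hull C2 ->]]]].
  by rewrite -[w1]scale1r; apply: CZD => //; apply: CN.
move=> Cw; exists w, (rpos w), (rneg w); rewrite rpos_sub_rneg; split=> //.
  by apply: hull_ext_pos; [exact: rpos_ge0|apply: CU].
by apply: hull_ext_pos; [exact: rneg_ge0|apply: CU => //; apply: CN].
Qed.

Lemma ext_range_riesz : riesz_subspace (ext_range iota F).
Proof. by rewrite ext_rangeE; exact: hull_riesz. Qed.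

Lemma ext_range_sup : sup_closed (ext_range iota F).
Proof.
rewrite ext_rangeE; apply: (clamp_hull_sup unitU) => //.
by move=> B s a; exact: image_range_sup.
Qed.

Lemma ext_range_one : ext_range iota F 1.
Proof.
rewrite ext_rangeE.
apply: sub_clamp_hull image_range_riesz image_range_unit _ _.
exact: image_range_unit.
Qed.

Lemma ext_range_mul x y :
  ext_range iota F x -> ext_range iota F y -> ext_range iota F (x * y).
Proof.
by apply: riesz_subspace_mul => //;
  [exact: ext_range_riesz|exact: ext_range_sup|exact: ext_range_one].
Qed.

Lemma ext_range_bounded x : ext_range iota F x -> 0 <= x -> x <= 1 -> A x.
Proof.
rewrite ext_rangeE => Cx x0 x1.
apply: (@clamp_hull_bounded _ _ (1 : U) _ x 1 0) => //.
  by rewrite scale1r.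
by rewrite scale0r oppr0.
Qed.

End OneExpectation.

Lemma ext_range_mono F G : conditional_expectation e F ->
  conditional_expectation e G -> range F `<=` range G ->
  ext_range iota F `<=` ext_range iota G.
Proof.
move=> cF cG FG; rewrite !ext_rangeE // => x Cx a b a0 b0.
by have [y Fy <-] := Cx a b a0 b0; exists y => //; apply: FG.
Qed.


(** * One period and several periods *)

(** [supremum] returns a default value when no supremum exists; Dedekind completeness rules this
    case out here. *)
Lemma supremum_ub (B : set U) x y : ubound B y -> B x -> x <= supremum 0 B.
Proof.
move=> By Bx; rewrite /supremum ifF; last first.
  by apply/negP => /eqP B0; rewrite B0 in Bx.
have DU : dedekind_complete U by case: U_completion => _ _ [].
have [|s sup_s] := @dedekind_complete_sup _ _ B y DU _ By; first by exists x.
by rewrite (xgetPex 0 (ex_intro _ s sup_s)).1.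
Qed.

Lemma infimum_lb (B : set U) x y : lbound B y -> B x -> infimum 0 B <= x.
Proof.
move=> By Bx; rewrite /infimum ifF; last first.
  by apply/negP => /eqP B0; rewrite B0 in Bx.
have DU : dedekind_complete U by case: U_completion => _ _ [].
have [|s inf_s] := @dedekind_complete_inf _ _ B y DU _ By; first by exists x.
by rewrite (xgetPex 0 (ex_intro _ s inf_s)).1.
Qed.

(** * One trading period *)

Section OneStep.
Variable F : E -> E.
Hypothesis condF : conditional_expectation e F.

Local Notation C := (ext_range iota F).

Let archU := completion_archimedean.

Let C0 : C 0. Proof. by case: (ext_range_riesz condF). Qed.
Let CZD a x y : C x -> C y -> C (a *: x + y).
Proof. by case: (ext_range_riesz condF) => _ + _ _; apply. Qed.
Let CU x y : C x -> C y -> C (x `|` y)%O.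
Proof. by case: (ext_range_riesz condF) => _ _ + _; apply. Qed.
Let CI x y : C x -> C y -> C (x `&` y)%O.
Proof. by case: (ext_range_riesz condF) => _ _ _; apply. Qed.

Lemma ext_rangeD x y : C x -> C y -> C (x + y).
Proof. by move=> Cx Cy; rewrite -[x]scale1r; apply: CZD. Qed.

Lemma ext_rangeZ a x : C x -> C (a *: x).
Proof. by move=> Cx; rewrite -[_ *: _]addr0; apply: CZD. Qed.

Lemma ext_rangeN x : C x -> C (- x).
Proof. by rewrite -scaleN1r; apply: ext_rangeZ. Qed.

Lemma ext_rangeB x y : C x -> C y -> C (x - y).
Proof. by move=> Cx Cy; apply: ext_rangeD => //; apply: ext_rangeN. Qed.

Lemma ext_range_rpos x : C x -> C (rpos x).
Proof. by move=> Cx; apply: CU. Qed.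

Lemma ext_range_rneg x : C x -> C (rneg x).
Proof. by move=> Cx; apply: CU => //; apply: ext_rangeN. Qed.

(** The indicator of {h > 0} is p = sup_n (n h /\ 1); whatever is disjoint from h is disjoint from
    p. *)
Lemma support_component h D : C h -> 0 <= h -> 0 <= h * D ->
  exists q : E, [/\ component e q, C (iota q),
    0 <= iota q <= 1 /\ iota q * iota q = iota q, 0 <= iota q * D &
    (iota q = 0 -> h = 0)].
Proof.
move=> Ch h0 hD; have one0 := @rone_ge0 R U.
have DU : dedekind_complete U by case: U_completion => _ _ [].
pose B := range (fun n => (h *+ n) `&` 1)%O.
have [||p sup_p] := @dedekind_complete_sup _ _ B (1 : U) DU.
- by exists ((h *+ 0) `&` 1)%O, 0%N.
- by move=> _ [n _ <-]; exact: leIr.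
have [ub lub] := sup_p.
have p0 : 0 <= p.
  by apply: ub; exists 0%N => //; rewrite mulr0n meet_l.
have p1 : p <= 1 by apply: lub => _ [n _ <-]; exact: leIr.
have Cp : C p.
  apply: (ext_range_sup condF) sup_p; last by exists ((h *+ 0) `&` 1)%O, 0%N.
  move=> _ [n _ <-]; apply: CI; last exact: ext_range_one.
  by rewrite -scaler_nat; exact: ext_rangeZ.
have p_disj x : (h `&` x)%O = 0 -> (p `&` x)%O = 0.
  move=> hx; have x0 : 0 <= x by rewrite -hx leIr.
  apply/le_anti; rewrite lexI p0 x0 !andbT.
  have [_ lub_px] := sup_meet x sup_p. apply: lub_px => _ [_ [n _ <-] <-].
  have n0 : 0 <= n%:R *: (1 : U) by rewrite riesz_scaler_ge0.
  have := meet_mull_eq0 n0 hx.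
  by rewrite -rscalerAl mul1r scaler_nat => <-; rewrite leI2 // leIl.
(* Adding h /\ (1 - p) to n h /\ 1 gives at most (n+1) h /\ 1, hence at most p; so p + h /\ (1 - p)
   <= p. *)
have p_comp : (p `&` (1 - p))%O = 0.
  apply: p_disj; apply/le_anti; rewrite lexI h0 rsubr_ge0 p1 !andbT.
  rewrite -(rler_D2l p) addr0 -rlerBrDr; apply: lub => _ [n _ <-].
  rewrite rlerBrDr; apply: (@le_trans _ _ ((h *+ n.+1) `&` 1)%O); last first.
    by apply: ub; exists n.+1.
  rewrite lexI; apply/andP; split; first by rewrite mulrSr rlerD ?leIl.
  rewrite -[X in _ <= X](subrK p) addrC; apply: rlerD; first exact: leIr.
  by apply: ub; exists n.
(* Being between 0 and 1, p comes from E, where the components of [e] live. *)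
have [q Fq qE] := ext_range_bounded condF Cp p0 p1.
exists q; rewrite qE; split=> //.
- split; first by rewrite -(ler_iota U_completion) linear0 // qE.
  have [[_ _ iotaI] iota_inj _ _] := U_completion.
  by apply: iota_inj; rewrite iotaI linearB // qE e_one linear0.
- rewrite p0 p1; split=> //.
  have /eqP := disjoint_mul_eq0 p_comp.
  by rewrite mulrBr mulr1 subr_eq0 => /eqP.
(* h D^- = (h D)^- = 0, so h, and with it p, is disjoint from D^-; hence p D = p D^+. *)
- have hx : h * rneg D = 0.
    by rewrite mulrC -rnegM // /rneg join_r // mulrC rlerNl oppr0.
  have /p_disj/disjoint_mul_eq0 px :=
    mul_eq0_disjoint archU h0 (rneg_ge0 D) hx.
  by rewrite -(rpos_sub_rneg D) mulrBr px subr0 rmulr_ge0 // rpos_ge0.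
- move=> pE; apply: (unit_disjoint_eq0 one_weak_order_unit h0).
  apply/le_anti; rewrite lexI h0 one0 !andbT -pE.
  by apply: ub; exists 1%N.
Qed.

Variables S0 S1 : U.
Hypothesis C_S0 : C S0.
Hypothesis S0_ge0 : 0 <= S0.
Hypothesis S1_ge0 : 0 <= S1.
Hypothesis spread : forall q : E, component e q -> 0 < q ->
  0 < iota q * (S0 - cond_m iota F S1) /\ 0 < iota q * (cond_M iota F S1 - S0).

Let component_eq0 q : component e q ->
  (iota q * (S0 - cond_m iota F S1) <= 0 \/
   iota q * (cond_M iota F S1 - S0) <= 0) -> iota q = 0.
Proof.
move=> q_comp le0; have [->|q0] := eqVneq q 0; first by rewrite linear0.
have [|lt1 lt2] := spread q_comp; first by rewrite lt_def q0; case: q_comp.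
by case: le0 => [/(lt_le_trans lt1)|/(lt_le_trans lt2)]; rewrite ltxx.
Qed.

Lemma no_sure_gain h : C h -> 0 <= h -> 0 <= h * (S1 - S0) -> h = 0.
Proof.
move=> Ch h0 hD.
have [q [q_comp Cq [/andP[q0 q1] qq] qD q_h]] := support_component Ch h0 hD.
apply/q_h/component_eq0 => //; left.
have qS0 : iota q * S0 <= cond_m iota F S1.
  apply: (@supremum_ub _ _ S1) => [x []//|]; split; first exact: ext_range_mul.
  apply: (@le_trans _ _ (iota q * S1)); first by rewrite -rsubr_ge0 -mulrBr.
  by rewrite -[X in _ <= X]mul1r; apply: rler_wpM2r.
rewrite mulrBr rsubr_le0 -{1}qq -mulrA.
exact: rler_wpM2l.
Qed.

Lemma no_sure_loss h : C h -> 0 <= h -> 0 <= h * (S0 - S1) -> h = 0.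
Proof.
move=> Ch h0 hD.
have [q [q_comp Cq [/andP[q0 q1] qq] qD q_h]] := support_component Ch h0 hD.
apply/q_h/component_eq0 => //; right; rewrite mulrBr rsubr_le0.
rewrite /cond_M; set B := [set g | _].
have [B0|/set0P[g [Cg S1g]]] := eqVneq B set0.
  (* The infimum of the empty set is the default value 0. *)
  by rewrite /infimum B0 eqxx mulr0 rmulr_ge0.
have q'0 : 0 <= 1 - iota q by rewrite rsubr_ge0.
(* q S0 alone need not dominate S1 off the support of q, so it is pasted there with some g in [C]
   above S1; multiplying by q removes g again. *)
suff /(rler_wpM2l q0) : infimum 0 B <= iota q * S0 + (1 - iota q) * g.
  by rewrite mulrDr !mulrA mulrBr mulr1 qq subrr mul0r addr0.
apply: (@infimum_lb _ _ S1) => [x []//|]; split.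
  apply: ext_rangeD; apply: ext_range_mul => //.
  by apply: ext_rangeB => //; exact: ext_range_one.
have -> : S1 = iota q * S1 + (1 - iota q) * S1 by ring.
by apply: rlerD; [rewrite -rsubr_ge0 -mulrBr|apply: rler_wpM2l].
Qed.

(** For h of any sign, (h^+)^2 D = h^+ (h D) and (h^-)^2 (-D) = h^- (h D) are nonnegative, so the
    squares fall under the two preceding lemmas. *)
Lemma gain_ge0_eq0 h : C h -> 0 <= h * (S1 - S0) -> h = 0.
Proof.
move=> Ch hD; set D := S1 - S0 in hD *.
have Cp := ext_range_rpos Ch; have Cn := ext_range_rneg Ch.
have hp : rpos h = 0.
  apply/(rsqr_eq0 archU)/no_sure_gain.
  - exact: ext_range_mul.
  - exact: rsqr_ge0.
  rewrite -rpos_mul -mulrA.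
  by rewrite rmulr_ge0 // rpos_ge0.
have hn : rneg h = 0.
  apply/(rsqr_eq0 archU)/no_sure_loss.
  - exact: ext_range_mul.
  - exact: rsqr_ge0.
  rewrite -opprB mulrN -mulNr -rneg_mul -mulrA.
  by rewrite rmulr_ge0 // rneg_ge0.
by rewrite -(rpos_sub_rneg h) hp hn subrr.
Qed.

(** With n = p^-, multiplying by n gives n^2 <= (n h) D. So n h is a strategy with nonnegative gain,
    hence 0, and n^2 = 0. *)
Lemma price_ge0 p h : C p -> C h -> 0 <= p + h * (S1 - S0) -> 0 <= p.
Proof.
move=> Cp Ch; set D := S1 - S0 => hD; apply: rneg_eq0.
set n := rneg p; have n0 : 0 <= n := rneg_ge0 p.
have Cn : C n := ext_range_rneg Cp.
have nn : n * n <= n * h * D.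
  have := rmulr_ge0 n0 hD; rewrite mulrDr rneg_mul addrC rsubr_ge0.
  by rewrite mulrA.
have nh : n * h = 0.
  apply: gain_ge0_eq0; first exact: ext_range_mul.
  by apply: le_trans nn; exact: rsqr_ge0.
apply/(rsqr_eq0 archU)/le_anti; rewrite rsqr_ge0 andbT.
by apply: le_trans nn _; rewrite nh mul0r.
Qed.

End OneStep.
End ExtendedRange.

(** * Several trading periods *)

Section Market.
Context {R : realType} {E : rieszType R} {e : E} {U : fAlgType R}.
Context {iota : E -> U} {T : nat} {F : nat -> E -> E} {S : nat -> U}.
Hypothesis E_complete : dedekind_complete E.
Hypothesis U_completion : universal_completion iota.
Hypothesis e_one : iota e = 1.
Hypothesis F_filtration : filtration e T F.
Hypothesis S_price : price_process iota T F S.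
Hypothesis S_spread : forall p : E, component e p -> 0 < p ->
  forall t, (t < T)%N ->
    0 < iota p * (S t - cond_m iota (F t) (S t.+1)) /\
    0 < iota p * (cond_M iota (F t) (S t.+1) - S t).

Let condF t : (t <= T)%N -> conditional_expectation e (F t).
Proof. by case: F_filtration => + _; apply. Qed.

Let F_mono i j : (i <= j <= T)%N ->
  ext_range iota (F i) `<=` ext_range iota (F j).
Proof.
case/andP=> ij jT; have iT := leq_trans ij jT.
apply: (ext_range_mono E_complete U_completion e_one (condF iT) (condF jT)).
move: ij; rewrite leq_eqVlt => /predU1P[->//|ij] _ [x _ <-].
have [_ tower] := F_filtration.
have ijT : (i < j <= T)%N by rewrite ij.
by have [_ <-] := tower i j ijT x; exists (F i x).
Qed.

Definition partial_gain (theta : nat -> U) t k : U :=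
  \sum_(t.+1 <= i < k.+1) theta i.-1 * (S i - S i.-1).

Lemma partial_gain_recr theta t k : (t <= k)%N ->
  partial_gain theta t k.+1 = partial_gain theta t k + theta k * (S k.+1 - S k).
Proof. by move=> tk; rewrite /partial_gain big_nat_recr. Qed.

Lemma partial_gain0 theta t : partial_gain theta t t = 0.
Proof. by rewrite /partial_gain big_geq. Qed.

Variables (theta : nat -> U) (t : nat).
Hypothesis tT : (t <= T)%N.
Hypothesis C_theta : forall i, (t <= i < T)%N -> ext_range iota (F i) (theta i).

Lemma partial_gain_range k : (t <= k <= T)%N ->
  ext_range iota (F k) (partial_gain theta t k).
Proof.
elim: k => [|k IH] /andP[tk kT].
  have -> : t = 0%N by apply/eqP; rewrite -leqn0.
  rewrite partial_gain0.
  by case: (ext_range_riesz E_complete U_completion e_one (condF kT)).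
move: tk; rewrite leq_eqVlt => /predU1P[->|/[!ltnS] tk].
  rewrite partial_gain0.
  by case: (ext_range_riesz E_complete U_completion e_one (condF kT)).
have [S_range _ _] := S_price; have ck := condF kT.
have mono := @F_mono k k.+1; rewrite leqnSn kT in mono.
have {}mono := mono isT.
rewrite partial_gain_recr //.
apply: (ext_rangeD E_complete U_completion e_one ck).
  by apply/mono/IH; rewrite tk ltnW.
apply: (ext_range_mul E_complete U_completion e_one ck).
  by apply/mono/C_theta; rewrite tk.
apply: (ext_rangeB E_complete U_completion e_one ck); first exact: S_range.
by apply/mono/S_range/ltnW.
Qed.

Lemma partial_price_ge0 c k : ext_range iota (F t) c ->
  0 <= c + partial_gain theta t T -> (t <= k <= T)%N ->
  0 <= c + partial_gain theta t k.
Proof.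
move=> Cc cT /andP[tk kT]; move: tk.
(* Descending induction on k, run as induction on T - k; each step is [price_ge0] on one period. *)
rewrite -(subKn kT); have : (T - k <= T)%N by exact: leq_subr.
elim: (T - k)%N => [|j IH] jT tk; first by rewrite subn0.
have {}IH := IH (ltnW jT) (leq_trans tk (leq_sub2l _ (leqnSn j))).
set i := (T - j.+1)%N in tk *.
have iE : (T - j)%N = i.+1 by rewrite /i subnSK.
have iT : (i < T)%N by rewrite -iE leq_subr.
have [S_range S_ge0 _] := S_price.
rewrite iE partial_gain_recr // addrA in IH.
apply: (price_ge0 E_complete U_completion e_one (condF (ltnW iT))) IH.
- exact/S_range/ltnW.
- exact/S_ge0/ltnW.
- exact: S_ge0.
- by move=> q q_comp q0; exact: S_spread.
- apply: (ext_rangeD E_complete U_completion e_one (condF (ltnW iT))).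
    by apply: F_mono Cc; rewrite tk ltnW.
  by apply: partial_gain_range; rewrite tk ltnW.
- by apply: C_theta; rewrite tk.
Qed.

(** Forward induction: the gain up to k is 0, and the gain up to k+1 is nonnegative by
    [partial_price_ge0] with c = 0, so the single increment is nonnegative and [theta k]
    vanishes. *)
Lemma partial_gain_eq0 k : 0 <= partial_gain theta t T -> (t <= k <= T)%N ->
  partial_gain theta t k = 0.
Proof.
move=> gT; have C0 : ext_range iota (F t) 0.
  by case: (ext_range_riesz E_complete U_completion e_one (condF tT)).
elim: k => [|k IH] /andP[tk kT].
  have -> : t = 0%N by apply/eqP; rewrite -leqn0.
  exact: partial_gain0.
move: tk; rewrite leq_eqVlt => /predU1P[->|/[!ltnS] tk].
  exact: partial_gain0.
have [S_range S_ge0 _] := S_price.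
have g1 : 0 <= partial_gain theta t k.+1.
  rewrite -[X in _ <= X]add0r partial_price_ge0 ?add0r //.
  by rewrite kT ltnW.
have tkT : (t <= k <= T)%N by rewrite tk ltnW.
rewrite partial_gain_recr // (IH tkT) add0r in g1 *.
have -> : theta k = 0; last by rewrite mul0r.
apply: (gain_ge0_eq0 E_complete U_completion e_one (condF (ltnW kT))) g1.
- exact/S_range/ltnW.
- exact/S_ge0/ltnW.
- exact: S_ge0.
- by move=> q q_comp q0; exact: S_spread.
- by apply: C_theta; rewrite tk.
Qed.

End Market.

Theorem proposition33 (R : realType) (E : rieszType R) (e : E)
    (U : fAlgType R) (iota : E -> U) (T : nat) (F : nat -> E -> E)
    (S : nat -> U)
    (E_complete : dedekind_complete E)
    (e_unit : weak_order_unit e)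
    (U_completion : universal_completion iota)
    (e_one : iota e = 1)
    (T_gt0 : (1 <= T)%N)
    (F_filtration : filtration e T F)
    (S_price : price_process iota T F S)
    (S_spread : forall p : E, component e p -> 0 < p ->
       forall t, (t < T)%N ->
         0 < iota p * (S t - cond_m iota (F t) (S t.+1)) /\
         0 < iota p * (cond_M iota (F t) (S t.+1) - S t)) :
  NA iota T F S <-> AIP iota T F S.
Proof.
have range0 t : (t <= T)%N -> ext_range iota (F t) 0.
  move=> tT; have [condF _] := F_filtration.
  by case: (ext_range_riesz E_complete U_completion e_one (condF _ tT)).
have gains0 t : gains iota T F S t 0.
  exists (fun=> 0); last by rewrite big1 // => i _; rewrite mul0r.
  by move=> i /andP[_ iT]; apply/range0/ltnW.
split=> _ t tT; apply/seteqP; split=> [x|_ ->].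
- move=> [[Cx [_ [theta C_theta ->] x_ge0]] [_ x_le0]].
  (* At k = t the partial gain is empty, so the backward induction bounds the price x itself from
     below by 0. *)
  apply/le_anti; rewrite x_le0 /=.
  have := partial_price_ge0 E_complete U_completion e_one F_filtration S_price
    S_spread C_theta Cx x_ge0 (k := t).
  by rewrite leqnn ltnW // partial_gain0 addr0; apply.
- split; last by split=> //; apply/range0/ltnW.
  by split; [apply/range0/ltnW|exists 0; rewrite ?addr0].
- move=> [[theta C_theta ->] [_ x_ge0]].
  apply: (partial_gain_eq0 E_complete U_completion e_one F_filtration S_price
    S_spread tT C_theta x_ge0).
  by rewrite leqnn tT.
- by split=> //; split=> //; exact: range0.
Qed.
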